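(* Let $D\subset\mathbb{R}^d$ be a bounded Lebesgue measurable domain with $0<\mathrm{Leb}(D)<\infty$, $D_M=\{x_1,\dots,x_M\}\subset D$ a discrete set of $M$ points, and $\nu_M(B)=\frac1M\sum_{j=1}^M\delta_{x_j}(B)$ for $B\subseteq D_M$. Let $\mathcal{A}$ be a separable Banach space with its Borel sigma algebra and $\mu$ a Borel probability measure on $\mathcal{A}$. For each $j\in\{1,\dots,M\}$ let $a\mapsto\mathcal{G}^\dagger(a)(x_j)\in\mathbb{R}^{d_u}$, $a\mapsto\hat{\mathcal{G}}_M(a)(x_j)\in\mathbb{R}^{d_u}$ and $a\mapsto\hat{\mathcal{E}}_M(a)(x_j)\in(0,\infty)$ be Borel measurable maps on $\mathcal{A}$. Let $\alpha,\gamma\in(0,1)$, $n\ge1$, and $k=\lceil(1-\alpha)(n+1)\rceil$. Suppose that $A_1,\dots,A_{n+1}$ are exchangeable $\mathcal{A}$-valued random variables with common law $\mu$. Let $\hat\lambda_M$ be the $k$th smallest value of $s_M(A_1),\dots,s_M(A_n)$ if $k\le n$, and $\hat\lambda_M=\infty$ otherwise. Then $$\mathbb{P}\Bigl(\nu_M\bigl(\{x_j\in D_M:\mathcal{G}^\dagger(A_{n+1})(x_j)\in C^M_{\hat\lambda_M}(A_{n+1})(x_j)\}\bigr)\ge1-\gamma\Bigr)\ \ge\ \frac{k}{n+1}\ \ge\ 1-\alpha .$$ Moreover, if the $A_i$ are i.i.d. and the distribution of $s_M(A_1)$ is atomless, then the random variable $\mathbb{P}\bigl(w^M_{\hat\lambda_M}(A_{n+1})\ge1-\gamma\mid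 A_1,\dots,A_n\bigr)$ follows a $\mathrm{Beta}(k,n+1-k)$ distribution and $$\mathbb{P}\Bigl(\nu_M\bigl(\{x_j\in D_M:\mathcal{G}^\dagger(A_{n+1})(x_j)\in C^M_{\hat\lambda_M}(A_{n+1})(x_j)\}\bigr)\ge1-\gamma\Bigr)=\frac{k}{n+1}\ \le\ 1-\alpha+\frac1{n+1}.$$
   Context: Here $\mathcal{G}^\dagger$ is the true operator, $\hat{\mathcal{G}}_M$ the prediction and $\hat{\mathcal{E}}_M$ the error estimator, evaluated on $D_M$. For $\lambda\in[0,\infty]$ the discrete prediction band is $C^M_\lambda(a)(x_j)=\{y\in\mathbb{R}^{d_u}:\|y-\hat{\mathcal{G}}_M(a)(x_j)\|_2\le\lambda\,\hat{\mathcal{E}}_M(a)(x_j)\}$ (so $C^M_\infty(a)(x_j)=\mathbb{R}^{d_u}$). The discrete residual field is $\rho_M(a,x_j)=\|\mathcal{G}^\dagger(a)(x_j)-\hat{\mathcal{G}}_M(a)(x_j)\|_2/\hat{\mathcal{E}}_M(a)(x_j)\in[0,\infty)$. The containment fraction is $w^M_\lambda(a)=\frac1M\sum_{j=1}^M\mathbf{1}\{\rho_M(a,x_j)\le\lambda\}$ and the score is $s_M(a)=\inf\{\lambda\ge0:w^M_\lambda(a)\ge1-\gamma\}$. Order statistics are counted with multiplicity. *)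

(* Defs.v *)
From HB Require Import structures.
From mathcomp Require Import all_boot all_order all_algebra all_fingroup.
From mathcomp Require Import all_classical all_reals all_analysis.

Set Implicit Arguments.
Unset Strict Implicit.
Unset Printing Implicit Defensive.

Import Order.TTheory GRing.Theory Num.Theory.
Import numFieldNormedType.Exports.

Local Open Scope classical_set_scope.
Local Open Scope ring_scope.

Notation borel T := (g_sigma_algebraType (@open T)).

Definition separable (T : topologicalType) : Prop :=
  exists2 S : set T, countable S & dense S.

Definition euclidean_norm (R : realType) (m : nat) (v : 'rV[R]_m) : R :=
  Num.sqrt (\sum_(i < m) v ord0 i ^+ 2).

Section lebesgue_Rd.
Context {R : realType} {d : nat}.

Definition box (a b : 'rV[R]_d) : set 'rV[R]_d :=
  [set y | forall i, a ord0 i < y ord0 i <= b ord0 i].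

Definition box_volume (a b : 'rV[R]_d) : R :=
  \prod_(i < d) Num.max 0 (b ord0 i - a ord0 i).

(* The index set J lets covers be finite or empty: for d = 0 there is no empty
   box with which to pad a sequence. *)
Definition lebesgue_outer (S : set 'rV[R]_d) : \bar R :=
  ereal_inf [set v | exists (J : set nat) (a b : nat -> 'rV[R]_d),
    S `<=` \bigcup_(k in J) box (a k) (b k) /\
    v = (\esum_(k in J) (box_volume (a k) (b k))%:E)%E].

(* Lebesgue measure on R^d is [lebesgue_outer] restricted to these sets. *)
Definition lebesgue_measurable (S : set 'rV[R]_d) : Prop :=
  lebesgue_outer.-caratheodory S.

End lebesgue_Rd.

Section probability_notions.
Context {disp disp' : measure_display} {Omega : measurableType disp}
  {T : measurableType disp'} {R : realType}.
Variable P : probability Omega R.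

Definition exchangeable (m : nat) (X : 'I_m -> {RV P >-> T}) : Prop :=
  forall (s : 'S_m) (B : set (m.-tuple T)), measurable B ->
    P [set w | B [tuple X (s i) w | i < m]] =
    P [set w | B [tuple X i w | i < m]].

(* Subfamilies are covered by taking B i = setT outside of them. *)
Definition mutually_independent (m : nat) (X : 'I_m -> {RV P >-> T}) : Prop :=
  forall B : 'I_m -> set T, (forall i, measurable (B i)) ->
    P (\bigcap_(i in [set: 'I_m]) (X i @^-1` B i)) =
    (\prod_(i < m) P (X i @^-1` B i))%E.

(* Z is a version of the conditional probability P(E | F). *)
Definition is_cond_prob (F : set (set Omega)) (E : set Omega) (Z : Omega -> R)
    : Prop :=
  [/\ forall B : set R, measurable B -> F (Z @^-1` B),
      P.-integrable [set: Omega] (EFin \o Z) &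
      forall H, F H -> (\int[P]_(w in H) (Z w)%:E = P (E `&` H))%E].

(* Y is [\bar R]-valued only because an infimum is; for finite Y this says that
   the law of Y on R has no atoms. *)
Definition atomless_law (Y : Omega -> \bar R) : Prop :=
  forall c : \bar R, P (Y @^-1` [set c]) = 0%E.

End probability_notions.

(* [beta_prob a b] is meant for positive parameters; Beta(a, 0) is the point
   mass at 1, the weak limit of Beta(a, b) as b -> 0. *)
Definition beta_law (R : realType) (a b : nat) : set R -> \bar R :=
  if b is 0%N then \d_(1 : R) else beta_prob a b.

Section prediction_band.
Context {R : realType} {A : Type} {d du M : nat}.
Variables (x : 'I_M -> 'rV[R]_d) (Gdag Ghat : A -> 'rV[R]_d -> 'rV[R]_du)
  (Ehat : A -> 'rV[R]_d -> R) (gamma : R).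

Definition nu_M (B : set 'rV[R]_d) : \bar R :=
  ((M%:R^-1)%:E * \sum_(j < M) @dirac _ (borel 'rV[R]_d) (x j) R B)%E.

Definition band (lam : \bar R) (a : A) (y : 'rV[R]_d) : set 'rV[R]_du :=
  [set u | ((euclidean_norm (u - Ghat a y))%:E <= lam * (Ehat a y)%:E)%E].

Definition residual (a : A) (y : 'rV[R]_d) : R :=
  euclidean_norm (Gdag a y - Ghat a y) / Ehat a y.

Definition containment (lam : \bar R) (a : A) : R :=
  M%:R^-1 * \sum_(j < M) ((residual a (x j))%:E <= lam)%E%:R.

Definition score (a : A) : \bar R :=
  ereal_inf [set lam | (0 <= lam)%E /\ 1 - gamma <= containment lam a].

Definition covered (lam : \bar R) (a : A) : set 'rV[R]_d :=
  [set y | range x y /\ band lam a y (Gdag a y)].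

(* k is counted from 1. *)
Definition lambda_hat (n k : nat) (a : 'I_n -> A) : \bar R :=
  if (k <= n)%N
  then nth +oo%E (sort <=%O [seq score (a i) | i <- enum 'I_n]) k.-1
  else +oo%E.

End prediction_band.

(* Main.v *)
Require Import Defs.
From HB Require Import structures.
From mathcomp Require Import all_boot all_order all_algebra all_fingroup.
From mathcomp Require Import all_classical all_reals all_analysis.
From mathcomp Require Import ring measurable_realfun.

(* The score of [a] is the K-th smallest residual, K = ceil((1 - gamma) M), so
   coverage of the test point by the band of radius lambda means that its score
   is at most lambda. With lambda the k-th smallest calibration score this says
   that fewer than k scores lie strictly below the test score. By
   exchangeability each of the n + 1 scores has this property with the same
   probability, and at least k of them always have it, exactly k if there are
   no ties.
   If the scores are i.i.d. with continuous distribution function F, then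
   F(lambda) is a version of the conditional coverage probability, by Fubini.
   Since {F <= t} is a half-line {y <= c} with F c = t, the event
   F(lambda) <= t means that at least k calibration scores are at most c; its
   probability is a binomial tail, whose derivative in t is the density of
   Beta(k, n + 1 - k). *)

Set Implicit Arguments.
Unset Strict Implicit.
Unset Printing Implicit Defensive.

Import Order.TTheory GRing.Theory Num.Theory.
Import numFieldNormedType.Exports.

Local Open Scope classical_set_scope.
Local Open Scope ring_scope.

(** * Ranks and order statistics *)

Lemma widen_ord_lift_max n (i : 'I_n) : widen_ord (leqnSn n) i = lift ord_max i.
Proof. by apply: val_inj; rewrite /= /bump leqNgt ltn_ord. Qed.

Lemma card_sum_pred (T : finType) (p : pred T) : #|p| = (\sum_(i : T) p i)%N.
Proof.
rewrite -sum1_card [LHS]big_mkcond; apply: eq_bigr => i _.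
by rewrite unfold_in; case: (p i).
Qed.

Lemma count_codom (T : finType) (U : Type) (f : T -> U) (p : pred U) :
  count p [seq f i | i <- enum T] = #|[pred i | p (f i)]|.
Proof.
by rewrite count_map -size_filter enumT cardE /enum_mem; congr (size _);
  apply: eq_filter.
Qed.

(** This lemma and the next turn comparisons with an order statistic into counts, which are blind to
    the order of the entries and handle ties correctly. *)
Lemma nth_sort_le_count d (T : orderType d) (x0 t : T) (s : seq T) k :
  (0 < k <= size s)%N ->
  (nth x0 (sort <=%O s) k.-1 <= t)%O = (k <= count (fun y => (y <= t)%O) s)%N.
Proof.
case: k => // k /= ks.
have ss : sorted <=%O (sort <=%O s) by exact: sort_le_sorted.
have /seq.permP ps : perm_eq (sort <=%O s) s by rewrite perm_sort.
rewrite -ps; apply/idP/idP; last by move=> h; exact: nth_count_le.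
apply: contraTT; rewrite -leqNgt -ltNge => h.
apply: nth_count_gt => //; rewrite size_sort ks andbT.
exact: h.
Qed.

Lemma le_nth_sort_count d (T : orderType d) (x0 t : T) (s : seq T) k :
  (0 < k <= size s)%N ->
  (t <= nth x0 (sort <=%O s) k.-1)%O = (count (fun y => (y < t)%O) s < k)%N.
Proof.
case: k => // k /= ks.
have ss : sorted <=%O (sort <=%O s) by exact: sort_le_sorted.
have /seq.permP ps : perm_eq (sort <=%O s) s by rewrite perm_sort.
rewrite -ps; apply/idP/idP; last first.
  by move=> h; apply: nth_count_ge => //; rewrite size_sort ks andbT.
apply: contraTT; rewrite -leqNgt -ltNge => h.
exact: nth_count_lt.
Qed.

(* [k] is at most the size of [T], so the set {i | rank i < k} contains the
   indices of the [k] smallest values. *)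
Lemma leq_card_rank d (U : orderType d) (T : finType) (f : T -> U) k :
  (k <= #|T|)%N ->
  (k <= #|[pred i | #|[pred j | (f j < f i)%O]| < k]|)%N.
Proof.
case: (posnP k) => [->//|k0] kT.
have /card_gt0P[i0 _] : (0 < #|T|)%N by exact: leq_trans kT.
pose s := [seq f i | i <- enum T].
have ks : (0 < k <= size s)%N by rewrite k0 size_map -cardT.
pose v := nth (f i0) (sort <=%O s) k.-1.
(* With [v] itself as threshold, at least [k] values are at most [v]. The same choice below shows
   that fewer than [k] values lie strictly under [v]. *)
have := nth_sort_le_count (f i0) v ks; rewrite lexx => /esym.
rewrite count_codom => /leq_trans; apply; apply: subset_leq_card.
apply/fintype.subsetP => i; rewrite !inE => fiv.
have := le_nth_sort_count (f i0) v ks; rewrite lexx => /esym.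
rewrite count_codom; apply: leq_ltn_trans; apply: subset_leq_card.
by apply/fintype.subsetP => j; rewrite !inE => /lt_le_trans; apply.
Qed.

(** The rank increases strictly with the value, so it is injective, and only [k] ranks lie below
    [k]. *)
Lemma card_rank_inj d (U : orderType d) (T : finType) (f : T -> U) k :
  injective f -> (k <= #|T|)%N ->
  #|[pred i | (#|[pred j | (f j < f i)%O]| < k)%N]| = k.
Proof.
move=> finj kT; apply/eqP; rewrite eqn_leq leq_card_rank// andbT.
pose r i := #|[pred j | (f j < f i)%O]|.
have rlt i j : (f i < f j)%O -> (r i < r j)%N.
  move=> ij; apply: proper_card; apply/properP; split.
    by apply/fintype.subsetP => l; rewrite !inE => /lt_trans; apply.
  by exists i; rewrite !inE ?ltxx.
have rinj : injective r.
  move=> i j rij; apply: finj; case: (ltgtP (f i) (f j)) => // /rlt;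
  by rewrite rij ltnn.
rewrite -[leqRHS](size_iota 0 k) -(size_image r).
apply: uniq_leq_size => [|m]; first by rewrite map_inj_uniq// enum_uniq.
by rewrite mem_iota => /mapP[i]; rewrite mem_enum inE => + ->.
Qed.

(** * The distribution function of the beta law *)

Section binomial_tail.
Variables (R : comNzRingType) (n k : nat).

(** The probability of at least [k] successes in [n] independent trials, as a polynomial in the
    success probability, so that it can be differentiated formally. *)
Definition binomial_tail : {poly R} :=
  \sum_(k <= j < n.+1) ('X^j * (1 - 'X) ^+ (n - j)) *+ 'C(n, j).

Lemma binomial_tail0 : (0 < k)%N -> binomial_tail.[0] = 0.
Proof.
move=> k0; rewrite horner_sum big_nat big1// => j /andP[kj _].
rewrite hornerMn !hornerE expr0n.
by rewrite gtn_eqF ?mul0r ?mul0rn// (leq_trans k0).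
Qed.

(** The summand of index [j] has derivative [g j - g j.+1]. The sum telescopes to [g k - g n.+1],
    and [g n.+1] vanishes with ['C(n, n.+1)]. *)
Lemma deriv_binomial_tail : (k <= n)%N ->
  binomial_tail^`() = ('X^(k.-1) * (1 - 'X) ^+ (n - k)) *+ (k * 'C(n, k)).
Proof.
move=> kn; pose g j : {poly R} :=
  ('X^(j.-1) * (1 - 'X) ^+ (n - j)) *+ (j * 'C(n, j)).
rewrite /binomial_tail linear_sum.
transitivity (\sum_(k <= j < n.+1) - (g j.+1 - g j)); last first.
  rewrite sumrN telescope_sumr ?leqW// /g bin_small// muln0 mulr0n.
  by rewrite sub0r opprK.
apply: eq_big_nat => j /andP[kj jn].
have d1X : (1 - 'X : {poly R})^`() = -1.
  by rewrite derivB derivX -polyC1 derivC sub0r.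
have cE : (j.+1 * 'C(n, j.+1) = (n - j) * 'C(n, j))%N by rewrite mul_bin_left.
rewrite /= derivMn derivM derivXn deriv_exp d1X /g opprB cE /= subnS.
rewrite mulrnDl mulrnAl -mulrnA; congr (_ + _).
by rewrite mulN1r mulNrn mulrN mulNrn mulrnA mulrnAr.
Qed.

End binomial_tail.

Lemma beta_funV_bin (R : realType) (n k : nat) : (0 < k <= n)%N ->
  (beta_fun k (n.+1 - k))^-1 = (k * 'C(n, k))%:R :> R.
Proof.
case: k => // k /= kn; rewrite beta_funE /= subSS.
have -> : (n - k == 0)%N = false by apply/negbTE; rewrite subn_eq0 -ltnNge.
rewrite /= subnKC 1?ltnW// -subnS invfM invrK -natrM.
apply: (canLR (mulKf _)); first by rewrite pnatr_eq0 -lt0n muln_gt0 !fact_gt0.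
by rewrite -natrM -(bin_fact kn) factS; congr _%:R; ring.
Qed.

(** On the unit interval the beta density is the derivative of the binomial tail, which vanishes at
    0 because [0 < k]. *)
Lemma beta_prob_itvNyc (R : realType) (n k : nat) (t : R) :
  (0 < k <= n)%N -> 0 <= t <= 1 ->
  beta_prob k (n.+1 - k) `]-oo, t] = ((binomial_tail R n k).[t])%:E.
Proof.
move=> kn /andP[t0 t1]; set c : R := (k * 'C(n, k))%:R.
have XE (x : R) : XMonemX k.-1 (n - k) x * c = (binomial_tail R n k)^`().[x].
  rewrite deriv_binomial_tail; last by case/andP: kn.
  by rewrite hornerMn !hornerE /XMonemX mulr_natr.
rewrite -integral_beta_pdf//.
transitivity (\int[lebesgue_measure]_(x in `[0%R, t])
    ((binomial_tail R n k)^`().[x])%:E)%E.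
  rewrite integral_mkcond [RHS]integral_mkcond; apply: eq_integral => y _.
  rewrite !patchE /beta_pdf beta_funV_bin// patchE !mem_setE !in_itv /=.
  have [yt|ty] := leP y t; last by rewrite andbF.
  rewrite andbT (le_trans yt t1) andbT; case: ifPn => _; last by rewrite mul0r.
  by rewrite -XE subSn//; case/andP: kn.
(* The fundamental theorem of calculus is applied on a nondegenerate interval, so [t = 0] is treated
   apart. *)
have [->|tn0] := eqVneq t 0.
  by rewrite set_itv1 integral_set1 binomial_tail0//; case/andP: kn.
rewrite (@continuous_FTC2 _ _ (horner (binomial_tail R n k))).
- by rewrite binomial_tail0 ?sube0//; case/andP: kn.
- by rewrite lt_neqAle eq_sym tn0.
- exact/continuous_subspaceT/continuous_horner.
- split; first by move=> x _; exact: derivable_horner.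
  + by apply: cvg_at_right_filter; exact: continuous_horner.
  + by apply: cvg_at_left_filter; exact: continuous_horner.
- by move=> x _; rewrite derivE.
Qed.

(** * Independence and conditional probabilities *)

Lemma bigcap_fintype (I : finType) U (F : I -> set U) :
  \bigcap_(i in [set: I]) F i = \big[setI/setT]_(i : I) F i.
Proof.
rewrite -bigcap_seq; apply: eq_bigcapl; split => // i _ /=.
by rewrite mem_index_enum.
Qed.

Lemma bigcap_fintype_measurable d (T : measurableType d) (I : finType)
    (F : I -> set T) : (forall i, measurable (F i)) ->
  measurable (\bigcap_(i in [set: I]) F i).
Proof.
move=> mF; rewrite bigcap_fintype.
by apply: big_ind => // *; exact: measurableI.
Qed.

Section independence_sigma.
Context d d' (Omega : measurableType d) (T : measurableType d') (R : realType).
Variables (P : probability Omega R) (n : nat) (A : 'I_n.+1 -> {RV P >-> T}).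

(* The intersections of events [A i \in B i] form a pi-system generating the
   sigma-algebra, so two finite measures agreeing on them agree everywhere. *)
Lemma mutually_independent_g_sigma_preimage (H : set Omega) (C : set T) :
  mutually_independent A ->
  g_sigma_preimage (fun i => A (lift ord_max i) : Omega -> T) H ->
  measurable C ->
  P (H `&` A ord_max @^-1` C) = (P H * P (A ord_max @^-1` C))%E.
Proof.
move=> Aind; pose rect (B : 'I_n -> set T) :=
  \bigcap_(i in [set: 'I_n]) (A (lift ord_max i) @^-1` B i).
pose G : set (set Omega) :=
  [set X | exists2 B : 'I_n -> set T,
    (forall i, measurable (B i)) & X = rect B].
have mA i (B : set T) : measurable B -> measurable (A i @^-1` B).
  by move=> mB; rewrite -[_ @^-1` _]setTI; exact: measurable_funP.
have Gm : G `<=` measurable.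
  by move=> _ [B mB ->]; apply: bigcap_fintype_measurable => i; exact: mA.
have GI : setI_closed G.
  move=> _ _ [B mB ->] [B' mB' ->].
  exists (fun i => B i `&` B' i); first by move=> i; exact: measurableI.
  by rewrite /rect -bigcapI; apply: eq_bigcapr => i _; rewrite preimage_setI.
have GT : G setT.
  by exists (fun=> setT) => //; rewrite /rect bigcapT.
have rectD (B : 'I_n -> set T) D :
    (forall i, measurable (B i)) -> measurable D ->
    P (rect B `&` A ord_max @^-1` D) =
    (\prod_(i < n) P (A (lift ord_max i) @^-1` B i) * P (A ord_max @^-1` D))%E.
  move=> mB mD.
  pose B' i := if unlift ord_max i is Some j then B j else D.
  have /Aind : forall i, measurable (B' i) by rewrite /B' => i; case: unlift.
  rewrite big_ord_recr bigcap_fintype big_ord_recr /= /B' unlift_none.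
  rewrite /rect bigcap_fintype.
  under eq_bigr do rewrite widen_ord_lift_max liftK.
  by under [in RHS]eq_bigr do rewrite widen_ord_lift_max liftK.
(* A generator constrains a single variable, so it is a rectangle whose other sides are [setT]. *)
have subG : g_sigma_preimage (fun i => A (lift ord_max i) : Omega -> T)
    `<=` <<s G >>.
  apply: sub_sigma_algebra2 => X.
  rewrite -bigcup_seq => -[i _ [B mB <-]].
  exists (fun j => if j == i then B else setT); first by move=> j; case: eqP.
  rewrite setTI; apply/seteqP; split => [w ABw j _|w /(_ i Logic.I)] /=.
    by case: eqP => // ->.
  by rewrite eqxx.
move=> /subG GH mC.
(* The two measures compared are [P] restricted to the event on [A ord_max] and [P] scaled by the
   probability [c] of that event. *)
set c : {nonneg R} := NngNum (fine_ge0 (measure_ge0 P (A ord_max @^-1` C))).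
have cE : c%:num%:E = P (A ord_max @^-1` C).
  by rewrite fineK// fin_num_measure//; exact: mA.
rewrite muleC -cE.
apply: (g_sigma_algebra_measure_unique G Gm (fun=> setT)
   (fun=> GT) _    (mrestr P (mA ord_max C mC)) (mscale c P) GI) => //.
- by rewrite bigcup_const//; exists 0%N.
- move=> _ [B mB ->].
  rewrite [LHS]rectD// -[RHS]/(c%:num%:E * P (rect B))%E cE muleC.
  congr (_ * _)%E.
  rewrite -[rect B]setIT -(preimage_setT (A ord_max)) rectD//.
  by rewrite preimage_setT probability_setT mule1.
- by move=> _; rewrite /= /mrestr setTI -cE ltry.
Qed.

End independence_sigma.

Section independent_pair.
Context d d1 d2 (Omega : measurableType d) (T1 : measurableType d1)
  (T2 : measurableType d2) (R : realType) (P : probability Omega R).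
Variables (X : {RV P >-> T1}) (Y : {RV P >-> T2}).
Hypothesis XYind : forall A B, measurable A -> measurable B ->
  P (X @^-1` A `&` Y @^-1` B) = (P (X @^-1` A) * P (Y @^-1` B))%E.

(** Independence makes the joint law the product of the marginal laws, and the product measure of
    [E] is the integral of the measures of its sections. *)
Lemma independent_pair_section (E : set (T1 * T2)) : measurable E ->
  P [set w | E (X w, Y w)] = (\int[P]_w P (Y @^-1` xsection E (X w)))%E.
Proof.
move=> mE.
have mXY : measurable_fun [set: Omega] (fun w => (X w, Y w)).
  exact: measurable_fun_pair.
pose XY : {mfun Omega >-> (T1 * T2)%type} := HB.pack (fun w => (X w, Y w))
  (isMeasurableFun.Build _ _ _ _ _ mXY).
have -> : P [set w | E (X w, Y w)] = distribution P XY E by [].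
rewrite -(@product_measure_unique _ _ _ _ _
  (distribution P X) (distribution P Y))//.
rewrite /product_measure1 ge0_integral_distribution//.
exact: measurable_fun_xsection.
Qed.

End independent_pair.

Section conditional_probability.
Context d (Omega : measurableType d) (R : realType) (P : probability Omega R).
Variables (G : set (set Omega)).
Hypothesis Gm : <<s G >> `<=` measurable.

(** The identity into [Omega] with the smaller sigma-algebra is a random variable that carries
    exactly the information of [G]. Its law is the restriction of [P] to [<<s G >>]. *)
Let idG_measurable :
  measurable_fun [set: Omega] (id : Omega -> g_sigma_algebraType G).
Proof. by move=> _ B mB; rewrite setTI; exact: Gm. Qed.

Let idG : {mfun Omega >-> g_sigma_algebraType G} :=
  HB.pack (id : Omega -> g_sigma_algebraType G)
    (isMeasurableFun.Build _ _ _ _ _ idG_measurable).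

(** Given [G] the value of [Y] is known while [X] keeps its law, so [Y] may be frozen and the
    probability of [X <= Y] read off the distribution function. *)
Lemma is_cond_prob_cdf (X : {RV P >-> R}) (Y : Omega -> R) :
  (forall H C, <<s G >> H -> measurable C ->
    P (H `&` X @^-1` C) = (P H * P (X @^-1` C))%E) ->
  (forall B : set R, measurable B -> <<s G >> (Y @^-1` B)) ->
  is_cond_prob P <<s G >> [set w | X w <= Y w] (fun w => fine (cdf X (Y w))).
Proof.
move=> GXind mY.
have mcdf : measurable_fun [set: R] (fun y => fine (cdf X y)).
  apply/measurable_EFinP; apply: eq_measurable_fun (cdf_measurable X) => r _ /=.
  by rewrite fineK// fin_num_measure.
have mYG : measurable_fun [set: g_sigma_algebraType G] Y.
  by move=> _ B mB; rewrite setTI; exact: mY.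
split.
- move=> B mB.
  rewrite -[_ @^-1` _]/(Y @^-1` ((fun y => fine (cdf X y)) @^-1` B)).
  by apply: mY; rewrite -[_ @^-1` _]setTI; exact: mcdf.
- apply: measurable_bounded_integrable => //.
  + by rewrite -ge0_fin_numE// fin_num_measure.
  + apply: (measurableT_comp mcdf) => _ B mB.
    by rewrite setTI; apply: Gm; exact: mY.
  + exists 1; split; first exact: num_real.
    move=> y y1 w _ /=; rewrite ger0_norm ?fine_ge0//.
    rewrite (le_trans _ (ltW y1))// -lee_fin fineK ?fin_num_measure//.
    exact: cdf_le1.
move=> H GH.
(* The section of [E] at [w] is the half-line up to [Y w] when [w] is in [H], and empty otherwise.
   Hence the section formula for the pair of [idG] and [X] yields the integral over [H]. *)
pose E : set (g_sigma_algebraType G * R) := [set u | H u.1 /\ u.2 <= Y u.1].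
have mE : measurable E.
  have -> : E = (H `*` setT) `&` ((fun u : g_sigma_algebraType G * R =>
      u.2 <= Y u.1) @^-1` [set true]).
    by apply/seteqP; split=> u [] //= [].
  apply: measurableI; first exact: measurableX.
  rewrite -[X in measurable X]setTI; apply: measurable_fun_ler => //.
  exact: measurableT_comp.
have := independent_pair_section (X := idG) GXind mE.
rewrite /E /= => EE.
rewrite setIC -[_ `&` _]/([set w | H w /\ X w <= Y w]) EE integral_mkcond.
apply: eq_integral => w _; rewrite patchE.
have [/set_mem Hw|/negP Hw] := boolP (w \in H).
  rewrite fineK ?fin_num_measure//; congr (P _).
  apply/seteqP; split => u.
    by rewrite /= in_itv /= => Xu; exact/xsectionP.
  by move=> /xsectionP[_ Xu]; rewrite /= in_itv.
rewrite (_ : _ @^-1` _ = set0) ?measure0//; apply/seteqP; split => // u.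
by move=> /xsectionP[/= /mem_set].
Qed.

(** Both versions are measurable for [<<s G >>] and have equal integrals over each of its sets, so
    they agree almost everywhere for the restricted measure, hence for [P]. *)
Lemma is_cond_prob_law_unique (E : set Omega) (Z Z' : Omega -> R) :
  is_cond_prob P <<s G >> E Z -> is_cond_prob P <<s G >> E Z' ->
  forall B : set R, measurable B -> P (Z @^-1` B) = P (Z' @^-1` B).
Proof.
move=> [mZ iZ ZE] [mZ' iZ' Z'E] B mB.
pose adapted (W : Omega -> R) :=
  forall B : set R, measurable B -> <<s G >> (W @^-1` B).
have mG (W : Omega -> R) : adapted W ->
    measurable_fun [set: g_sigma_algebraType G] (EFin \o W).
  move=> mW; apply/measurable_EFinP => _ C mC; rewrite setTI; exact: mW.
have : ae_eq (distribution P idG) setT (EFin \o Z) (EFin \o Z').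
  apply: integral_ae_eq => //.
  - by apply: integrable_pushforward => //; exact: mG.
  - exact: mG.
  - move=> H _ mH.
    have iH (W : Omega -> R) : P.-integrable [set: Omega] (EFin \o W) ->
        P.-integrable H (EFin \o W).
      by apply: integrableS => //; exact: Gm.
    rewrite !integral_pushforward//; [|exact: mG|exact: iH|exact: mG|exact: iH].
    by rewrite [LHS]ZE// [RHS]Z'E.
move=> [N [mN N0 ZN]].
have mGP (W : Omega -> R) : adapted W -> measurable (W @^-1` B).
  by move=> mW; apply: Gm; exact: mW.
have le (W W' : Omega -> R) : adapted W -> adapted W' ->
    (forall w, ~ N w -> W w = W' w) -> (P (W @^-1` B) <= P (W' @^-1` B))%E.
  move=> mW mW' WW'.
  have PN0 : P (N : set Omega) = 0%E by exact: N0.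
  rewrite -[leRHS]adde0 -[X in (_ <= _ + X)%E]PN0.
  have mN' : measurable (N : set Omega) by exact: Gm.
  apply: (@le_trans _ _ (P (W' @^-1` B `|` N))); last first.
    by apply: measureU2 => //; exact: mGP.
  apply: le_measure; rewrite ?inE; first exact: mGP.
    by apply: measurableU => //; exact: mGP.
  move=> w Ww; have [Nw|Nw] := pselect (N w); first by right.
  by left; rewrite /= -WW'.
have ZZ' w : ~ N w -> Z w = Z' w.
  by move=> Nw; apply: contra_notP Nw => ZZ'; apply: ZN => /= /(_ Logic.I) [].
apply/eqP; rewrite eq_le !le// => w Nw; exact/esym/ZZ'.
Qed.

End conditional_probability.

(** * Order statistics of independent variables *)

Lemma measure_finType_fibers d (T : measurableType d) (R : realType)
    (mu : {measure set T -> \bar R}) (I : finType) (f : T -> I) (Q : pred I) :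
  (forall i, measurable (f @^-1` [set i])) ->
  mu [set x | Q (f x)] = (\sum_(i | Q i) mu (f @^-1` [set i]))%E.
Proof.
move=> mf.
have -> : [set x | Q (f x)] = [set x | f x \in enum Q].
  by apply/seteqP; split => x; rewrite /= mem_enum.
have -> : (\sum_(i | Q i) mu (f @^-1` [set i]) =
    \sum_(i <- enum Q) mu (f @^-1` [set i]))%E.
  by rewrite big_enum.
elim: (enum Q) (enum_uniq Q) => [_|i s IHs /= /andP[nis /IHs {}IHs]].
  by rewrite big_nil -[RHS](measure0 mu); congr (mu _); apply/seteqP; split.
rewrite big_cons -IHs -measureU//.
- congr (mu _); apply/seteqP; split => x /=; rewrite inE; last first.
    by case=> [->|->]; rewrite ?eqxx ?orbT.
  by case/orP => [/eqP|]; [left|right].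
- elim: s {IHs nis} => [|j s IHs].
    by rewrite (_ : [set _ | _] = set0)//; apply/seteqP; split.
  rewrite (_ : [set _ | _] = f @^-1` [set j] `|` [set x | f x \in s]).
    exact: measurableU.
  apply/seteqP; split => x /=; rewrite inE; last first.
    by case=> [->|->]; rewrite ?eqxx ?orbT.
  by case/orP => [/eqP|]; [left|right].
- by apply/seteqP; split => // x [/= ->]; rewrite (negbTE nis).
Qed.

(** The sets [J], thought of as the sets of successful trials, are grouped by cardinality; there are
    ['C(n, j)] of cardinality [j]. *)
Lemma sum_card_geq_binomial_tail (R : comNzRingType) n k (p : R) :
  \sum_(J : {set 'I_n} | (k <= #|J|)%N) (p ^+ #|J| * (1 - p) ^+ (n - #|J|)) =
  (binomial_tail R n k).[p].
Proof.
rewrite /binomial_tail horner_sum big_geq_mkord.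
have cardJ (J : {set 'I_n}) : (#|J| < n.+1)%N.
  by rewrite ltnS -[leqRHS](card_ord n) max_card.
rewrite (partition_big (fun J : {set 'I_n} => Ordinal (cardJ J))
  (fun j : 'I_n.+1 => (k <= j)%N))//=.
apply: eq_bigr => j kj; rewrite hornerMn !hornerE.
have -> : 'C(n, j) = #|[set J : {set 'I_n} | #|J| == j]%SET|.
  by rewrite card_draws card_ord.
rewrite -sumr_const.
apply: eq_big => [J|J /andP[_ /eqP <-]//].
rewrite inE -val_eqE /=; case: eqP => [->|_]; last by rewrite andbF.
by rewrite kj.
Qed.

Section count_iid.
Context d (Omega : measurableType d) (R : realType) (P : probability Omega R).
Variables (n : nat) (S : 'I_n -> {RV P >-> R}).

(** The event is split according to the set [J w] of indices whose value is at most [t]. Fixing this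
    set gives a product event, whose probability is found by independence. *)
Lemma mutually_independent_count_le k (p t : R) : mutually_independent S ->
  (forall i, P (S i @^-1` `]-oo, t]) = p%:E) ->
  P [set w | (k <= #|[pred i | (S i w <= t)%R]|)%N] =
  ((binomial_tail R n k).[p])%:E.
Proof.
move=> Sind Sp.
pose J w : {set 'I_n} := [set i | S i w <= t]%SET.
pose B (K : {set 'I_n}) i : set R :=
  if i \in K then `]-oo, t]%classic else `]t, +oo[%classic.
have mB K i : measurable (B K i) by rewrite /B; case: ifP.
have fibE K : J @^-1` [set K] = \bigcap_(i in [set: 'I_n]) (S i @^-1` B K i).
  apply/seteqP; split => [w <- i _|w SB].
    rewrite /B /= inE; case: leP => h; rewrite /= in_itv /= ?h ?andbT//.
  apply/setP => i; rewrite inE; have := SB i Logic.I; rewrite /B /=.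
  by case: (i \in K); rewrite /= in_itv /= ?andbT; case: leP.
have mS i D : measurable D -> measurable (S i @^-1` D).
  by move=> mD; rewrite -[_ @^-1` _]setTI; exact: measurable_funP.
have -> : [set w | (k <= #|[pred i | (S i w <= t)%R]|)%N] =
    [set w | (k <= #|J w|)%N].
  by apply/seteqP; split => w /=; rewrite /J cardsE.
rewrite (@measure_finType_fibers _ _ _ P _ J (fun K => k <= #|K|)%N);
  last first.
  by move=> K; rewrite fibE; apply: bigcap_fintype_measurable => i; exact: mS.
rewrite -sum_card_geq_binomial_tail -sumEFin; apply: eq_bigr => K _.
rewrite fibE [LHS](Sind _ (mB K)).
rewrite (bigID (fun i => i \in K)) /= EFinM; congr (_ * _)%E.
  rewrite -prodr_const -prodEFin; apply: eq_bigr => i iK.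
  by rewrite /B iK Sp.
have -> : (n - #|K| = #|~: K|)%N by rewrite [RHS]cardsCs finset.setCK card_ord.
rewrite -prodr_const -prodEFin; apply: eq_big => [i|i iK]; first by rewrite inE.
rewrite /B (negbTE iK) -setCitvl preimage_setC probability_setC ?Sp//.
exact: (mS i `]-oo, t]%classic).
Qed.

End count_iid.

Section cdf_atomless.
Context d (Omega : measurableType d) (R : realType) (P : probability Omega R).
Variable X : {RV P >-> R}.
Hypothesis X0 : forall c : R, P (X @^-1` [set c]) = 0%E.

(** Left continuity in the form needed for a supremum: without an atom at [c], [cdf X c] is the
    probability of the open half-line, an increasing union of closed ones. *)
Lemma cdf_le_of_left (c : R) (t : \bar R) :
  (forall y, y < c -> (cdf X y <= t)%E) -> (cdf X c <= t)%E.
Proof.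
move=> Xt.
have -> : cdf X c = distribution P X `]-oo, c[.
  rewrite /cdf -(@setUitv1 _ _ _ _ true)// measureU//.
    by rewrite -[X in (_ + X)%E]/(P (X @^-1` [set c])) X0 adde0.
  by apply/seteqP; split => // y [/= + yc]; rewrite yc in_itv /= ltxx.
have E : `]-oo, c[%classic = \bigcup_n `]-oo, c - n.+1%:R^-1]%classic.
  apply/seteqP; split => [y /=|y [n _ /=]]; rewrite !in_itv /=; last first.
    by move=> /le_lt_trans; apply; rewrite ltrBlDr ltrDl.
  move=> yc; have [n nc] := ltr_add_invr yc; exists n => //=.
  by rewrite in_itv /= lerBrDr ltW.
rewrite E.
apply: (cvge_to_le (nondecreasing_cvg_mu _ _ _)) => //.
- exact: bigcup_measurable.
- move=> m n mn; apply/subsetPset => y /=.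
  rewrite !in_itv /= => /le_trans; apply.
  by rewrite lerD2l lerN2 lef_pV2 ?posrE// ler_nat.
- by apply: nearW => n; apply: Xt; rewrite ltrBlDr ltrDl.
Qed.

Lemma cdf_ge_of_right (c : R) (t : \bar R) :
  (forall y, c < y -> (t <= cdf X y)%E) -> (t <= cdf X c)%E.
Proof.
move=> Xt; apply: (cvge_to_ge (@cdf_right_continuous _ _ _ P X c)).
by near=> y; apply: Xt; near: y; exact: nbhs_right_gt.
Unshelve. all: by end_near. Qed.

(** The point [c] is the supremum of the set where [cdf X] is at most [t]. The set is bounded since
    [t < 1] and [cdf X] tends to 1, and continuity from both sides gives the value [t] at [c]. If
    the set is empty, the limit 0 at minus infinity forces [t = 0]. *)
Lemma cdf_le_threshold (t : R) : 0 <= t < 1 ->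
  (t = 0 /\ forall y, ~ (cdf X y <= t%:E)%E) \/
  exists2 c, cdf X c = t%:E & forall y, (cdf X y <= t%:E)%E = (y <= c).
Proof.
move=> /andP[t0 t1].
pose A := [set y | (cdf X y <= t%:E)%E].
have [Ay|A0] := pselect (exists y, A y); last first.
  left; split; last by move=> y Ay; apply: A0; exists y.
  apply/eqP; rewrite eq_le t0 andbT -lee_fin.
  apply: (cvge_to_ge (@cvg_cdfNy0 _ _ _ P X)); apply: nearW => y.
  by rewrite leNgt; apply/negP => /ltW yt; apply: A0; exists y.
right; have ubA : has_ubound A.
  apply: contrapT => /has_ubPn nubA; move: t1; rewrite ltNge => /negP; apply.
  rewrite -lee_fin; apply: (cvge_to_le (@cvg_cdfy1 _ _ _ P X)).
  apply: nearW => y; have [a Aa ya] := nubA y.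
  by apply: le_trans Aa; exact/cdf_nondecreasing/ltW.
have supA : has_sup A by split.
have Ft : cdf X (sup A) = t%:E.
  apply/eqP; rewrite eq_le; apply/andP; split.
    apply: cdf_le_of_left => y yA; have [a Aa ya] := sup_gt supA.1 yA.
    by apply: le_trans Aa; exact/cdf_nondecreasing/ltW.
  apply: cdf_ge_of_right => y sy; rewrite leNgt; apply/negP => /ltW yt.
  by move: sy; rewrite ltNge ub_le_sup.
exists (sup A) => // y; apply/idP/idP => [yt|yA]; first exact: ub_le_sup.
by rewrite -Ft cdf_nondecreasing.
Qed.
End cdf_atomless.

Lemma measure_unique_itvNyc (R : realType) (m1 m2 : probability R R) :
  (forall t : R, m1 `]-oo, t]%classic = m2 `]-oo, t]%classic) ->
  forall B : set R, measurable B -> m1 B = m2 B.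
Proof.
move=> m12; apply: (measure_unique (@RGenOInfty.G R)
  (fun n => `]- n%:R, +oo[%classic)).
- exact: RGenOInfty.measurableE.
- move=> _ _ [x ->] [y ->]; exists (Num.max x y); apply/seteqP; split => z /=;
    rewrite !in_itv /= !andbT gt_max; first by move=> [-> ->].
  by move=> /andP[].
- by move=> n; exists (- n%:R).
- apply/seteqP; split => // z _; exists (Num.truncn `|z|).+1 => //=.
  rewrite in_itv /= andbT ltrNl (le_lt_trans (ler_norm _))// normrN.
  exact: truncnS_gt.
- have E (m : probability R R) x :
      m `]x, +oo[%classic = (1 - m `]-oo, x]%classic)%E.
    by rewrite -setCitvl probability_setC.
  by move=> _ [x ->]; rewrite [LHS](E m1) [RHS](E m2) m12.
- by move=> k; rewrite (le_lt_trans (probability_le1 _ _)) ?ltry.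
Qed.

Section order_statistic.
Context d (Omega : measurableType d) (R : realType) (P : probability Omega R).
Variables (n k : nat) (S : 'I_n -> {RV P >-> R}) (X : {RV P >-> R}).
Variable Y : {RV P >-> R}.

(* [cdf X] maps the k-th order statistic to that of n uniform variables. *)
Lemma cdf_order_statistic_beta :
  (0 < k <= n)%N -> mutually_independent S ->
  (forall i t, P (S i @^-1` `]-oo, t]) = cdf X t) ->
  (forall c : R, P (X @^-1` [set c]) = 0%E) ->
  (forall w t, (Y w <= t) = (k <= #|[pred i | (S i w <= t)%R]|)%N) ->
  forall B : set R, measurable B ->
  P ((fun w => fine (cdf X (Y w))) @^-1` B) = beta_prob k (n.+1 - k) B.
Proof.
move=> kn Sind SX X0 Yk.
have mF : measurable_fun [set: Omega] (fun w => fine (cdf X (Y w))).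
  apply/measurable_EFinP.
  apply: eq_measurable_fun
    (measurableT_comp (cdf_measurable X) (measurable_funP Y)).
  by move=> w _ /=; rewrite fineK// fin_num_measure.
pose Z : {mfun Omega >-> R} := HB.pack (fun w => fine (cdf X (Y w)))
  (isMeasurableFun.Build _ _ _ _ _ mF).
move=> B mB; rewrite -[LHS]/(distribution P Z B).
(* [beta_prob] lives on [measurableTypeR R], whose sigma-algebra agrees with
   that of [R] only up to conversion. *)
have mid : measurable_fun [set: measurableTypeR R]
    (idfun : measurableTypeR R -> R) by exact: measurable_id.
pose idR : {mfun measurableTypeR R >-> R} := HB.pack
  (idfun : measurableTypeR R -> R)
  (isMeasurableFun.Build _ _ _ _ _ mid).
rewrite -[RHS]/(distribution (beta_prob k (n.+1 - k)) idR B).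
apply: measure_unique_itvNyc => // t.
rewrite -[LHS]/(P (Z @^-1` `]-oo, t]%classic)).
rewrite -[RHS]/(beta_prob k (n.+1 - k) `]-oo, t]%classic).
have FE w : (fine (cdf X (Y w)) <= t) = (cdf X (Y w) <= t%:E)%E.
  by rewrite -lee_fin fineK ?fin_num_measure.
have -> : Z @^-1` `]-oo, t] = [set w | (cdf X (Y w) <= t%:E)%E].
  by apply/seteqP; split => w /=; rewrite in_itv /= FE.
have [t0|t0] := ltP t 0.
  rewrite (_ : [set _ | _] = set0); last first.
    apply/seteqP; split => // w /=; apply/negP; rewrite -ltNge.
    by apply: lt_le_trans (cdf_ge0 _ _); rewrite lte_fin.
  rewrite measure0; apply/esym/eqP; rewrite eq_le measure_ge0 andbT.
  (* The half-line up to a negative [t] lies in the one up to 0, which is already null. *)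
  have <- : beta_prob k (n.+1 - k) `]-oo, 0%R] = 0%E :> \bar R.
    by rewrite beta_prob_itvNyc ?lexx ?ler01// binomial_tail0//; case/andP: kn.
  apply: le_measure; rewrite ?inE// => y /=; rewrite !in_itv /= => /le_trans.
  by apply; exact: ltW.
have [t1|t1] := leP 1 t.
  rewrite (_ : [set _ | _] = setT); last first.
    apply/seteqP; split => // w _ /=.
    by apply: le_trans (cdf_le1 _ _) _; rewrite lee_fin.
  rewrite probability_setT; apply/eqP; rewrite eq_le probability_le1// andbT.
  rewrite -(beta_prob01 k (n.+1 - k)); apply: le_measure; rewrite ?inE//.
  by move=> y /=; rewrite !in_itv /= => /andP[_ /le_trans]; apply.
rewrite beta_prob_itvNyc//; last by rewrite t0 ltW.
(* In the last case the event is [Y w <= c], that is, at least [k] of the [S i w] are at most [c],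
   each with probability [cdf X c = t]. *)
have [|[t00 FN]|[c Fc FcE]] := @cdf_le_threshold _ _ _ P X X0 t.
  by rewrite t0.
  rewrite (_ : [set _ | _] = set0); last by apply/seteqP; split => // w /FN.
  by rewrite measure0 t00 binomial_tail0//; case/andP: kn.
rewrite -(@mutually_independent_count_le _ _ _ P n S k t c Sind).
  by congr (P _); apply/seteqP; split => w /=; rewrite FcE Yk.
by move=> i; rewrite SX.
Qed.
End order_statistic.

(** * Ranks of exchangeable variables *)

(** The count depends only on the set of indices at which [f i x] holds, so the event is a finite
    union over the possible sets [K]. *)
Lemma measurable_count_lt d (T : measurableType d) (I : finType)
    (f : I -> T -> bool) k : (forall i, measurable_fun [set: T] (f i)) ->
  measurable [set x | (#|[pred i | f i x]| < k)%N].
Proof.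
move=> mf.
have -> : [set x | (#|[pred i | f i x]| < k)%N] =
    \bigcup_(K in [set K : {set I} | (#|K| < k)%N])
      \bigcap_(i in [set: I]) (f i @^-1` [set i \in K]).
  apply/seteqP; split => [x xk|x [K /= Kk fK] /=].
    exists [set i | f i x]%SET; first by rewrite /= cardsE.
    by move=> i _ /=; rewrite inE.
  rewrite (_ : #|[pred i | f i x]| = #|K|)//; apply: eq_card => i.
  by rewrite inE; exact: (fK i).
apply: fin_bigcup_measurable => [|K _]; first exact: finite_finset.
apply: bigcap_fintype_measurable => i; rewrite -[_ @^-1` _]setTI.
exact: mf.
Qed.

Lemma measure0_fin_bigcup d (T : measurableType d) (R : realType)
    (mu : {measure set T -> \bar R}) (I : choiceType) (D : set I)
    (F : I -> set T) :
  finite_set D -> (forall i, D i -> measurable (F i)) ->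
  (forall i, D i -> mu (F i) = 0%E) -> mu (\bigcup_(i in D) F i) = 0%E.
Proof.
move=> fD mF F0; rewrite -bigsetU_fset_set// big_seq.
set U := (X in mu X); suff [] : measurable U /\ mu U = 0%E by [].
rewrite {}/U; apply: (big_ind (fun A => measurable A /\ mu A = 0%E))
  => [|A B [mA A0] [mB B0]|i].
- by split; [|exact: measure0].
- split; first exact: measurableU.
  apply/eqP; rewrite eq_le measure_ge0 andbT.
  apply: (@le_trans _ _ (mu A + mu B)%E); first exact: measureU2.
  by rewrite A0 B0 adde0.
- by rewrite in_fset_set// inE => Di; split; [exact: mF|exact: F0].
Qed.

Section rank_probability.
Context d (Omega : measurableType d) (R : realType) (P : probability Omega R).
Variables (n k : nat) (S : 'I_n.+1 -> {RV P >-> R}).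

(** Only strictly smaller values count, so ties can only enlarge the event; this is why at least [k]
    of the events occur at every [w] when [k <= n.+1]. *)
Definition rank_lt (i : 'I_n.+1) : set Omega :=
  [set w | (#|[pred j | (S j w < S i w)%R]| < k)%N].

Lemma measurable_rank_lt i : measurable (rank_lt i).
Proof. by apply: measurable_count_lt => j; exact: measurable_fun_ltr. Qed.

Lemma exchangeable_rank_lt i : exchangeable S ->
  P (rank_lt i) = P (rank_lt ord_max).
Proof.
move=> Sex; pose B := [set u : n.+1.-tuple R |
  (#|[pred j | (tnth u j < tnth u ord_max)%R]| < k)%N].
have mB : measurable B.
  apply: measurable_count_lt => j.
  by apply: measurable_fun_ltr; exact: measurable_tnth.
(* Permuting the whole family does not change how many values lie below a given one; it only moves
   the distinguished index to [s ord_max]. *)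
have BE (s : 'S_n.+1) :
    [set w | B [tuple S (s j) w | j < n.+1]] = rank_lt (s ord_max).
  apply/funext => w; rewrite /B /rank_lt /=; congr (is_true (_ < k)%N).
  rewrite !card_sum_pred [RHS](reindex_inj (@perm_inj _ s)) /=.
  by apply: eq_bigr => j _; rewrite !tnth_mktuple.
have := Sex (tperm i ord_max) B mB; rewrite BE tpermR => ->.
have := BE 1%g; rewrite perm1 => <-; congr (P _).
apply/funext => w; congr (B _); apply: eq_from_tnth => j.
by rewrite !tnth_mktuple perm1.
Qed.

(** Under exchangeability its expectation is [n.+1] times the probability of [rank_lt ord_max], so
    pointwise information on this count determines or bounds that probability. *)
Let count_rank_lt w : \bar R := (\sum_(i < n.+1) (\1_(rank_lt i) w)%:E)%E.

Let count_rank_ltE w : count_rank_lt w =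
  (#|[pred i | (#|[pred j | (S j w < S i w)%R]| < k)%N]|%:R)%:E.
Proof.
rewrite /count_rank_lt sumEFin card_sum_pred natr_sum.
congr EFin; apply: eq_bigr => i _; rewrite indicE.
congr (_%:R); congr nat_of_bool.
by apply/idP/idP => [/set_mem //|h]; exact/mem_set.
Qed.

Let measurable_indic_rank_lt i :
  measurable_fun [set: Omega] (fun w => (\1_(rank_lt i) w)%:E : \bar R).
Proof.
by apply/measurable_EFinP; apply: measurable_indic; exact: measurable_rank_lt.
Qed.

Let measurable_count_rank_lt : measurable_fun [set: Omega] count_rank_lt.
Proof. by apply: emeasurable_sum => i; exact: measurable_indic_rank_lt. Qed.

Let count_rank_lt_ge0 w : (0 <= count_rank_lt w)%E.
Proof. by rewrite sume_ge0// => i _; rewrite lee_fin. Qed.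

Let integral_count_rank_lt :
  (\int[P]_w count_rank_lt w = \sum_(i < n.+1) P (rank_lt i))%E.
Proof.
rewrite ge0_integral_sum//.
apply: eq_bigr => i _; rewrite integral_indic ?setIT//.
exact: measurable_rank_lt.
Qed.

Let integral_cst_k : (\int[P]_w (cst k%:R%:E w) = k%:R%:E)%E.
Proof.
rewrite [LHS](integral_cst P measurableT).
by rewrite [X in (_ * X)%E]probability_setT mule1.
Qed.

Lemma exchangeable_rank_lt_ge : exchangeable S -> (k <= n.+1)%N ->
  ((k%:R / n.+1%:R)%:E <= P (rank_lt ord_max))%E.
Proof.
move=> Sex kn.
have : (k%:R%:E <= \sum_(i < n.+1) P (rank_lt i))%E.
  rewrite -integral_count_rank_lt -integral_cst_k.
  apply: ge0_le_integral => // w _; first by rewrite /= lee_fin.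
  rewrite -[leRHS]/(count_rank_lt w) count_rank_ltE lee_fin ler_nat.
  by apply: leq_card_rank; rewrite card_ord.
have Pfin : (fine (P (rank_lt ord_max)))%:E = P (rank_lt ord_max).
  by rewrite fineK// fin_num_measure//; exact: measurable_rank_lt.
rewrite (eq_bigr (fun=> (fine (P (rank_lt ord_max)))%:E)); last first.
  by move=> i _; rewrite Pfin; exact: exchangeable_rank_lt.
rewrite -[in X in _ -> X]Pfin sumEFin sumr_const card_ord.
by rewrite !lee_fin -[fine _ *+ _]mulr_natr => ?; rewrite ler_pdivrMr ?ltr0Sn.
Qed.

(** Outside the finite union of the null events of a tie the values are distinct, and the count is
    exactly [k] by [card_rank_inj]. *)
Lemma exchangeable_rank_lt_eq : exchangeable S -> (k <= n.+1)%N ->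
  (forall i j, i != j -> P [set w | S i w = S j w] = 0%E) ->
  P (rank_lt ord_max) = (k%:R / n.+1%:R)%:E.
Proof.
move=> Sex kn S_neq.
have measurable_tie (u : 'I_n.+1 * 'I_n.+1) :
    measurable [set w | S u.1 w = S u.2 w].
  rewrite (_ : [set _ | _] = (fun w => S u.1 w == S u.2 w) @^-1` [set true]).
    by rewrite -[_ @^-1` _]setTI; exact: measurable_fun_eqr.
  by apply/seteqP; split => w /eqP.
have : (k%:R%:E = \sum_(i < n.+1) P (rank_lt i))%E.
  rewrite -integral_count_rank_lt -integral_cst_k.
  apply: ge0_ae_eq_integral => //; first by move=> w _; rewrite /= lee_fin.
  exists (\bigcup_(u in [set u : 'I_n.+1 * 'I_n.+1 | u.1 != u.2])
    [set w | S u.1 w = S u.2 w]); split.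
  - apply: fin_bigcup_measurable => [|u _]; first exact: finite_finset.
    exact: measurable_tie.
  - apply: measure0_fin_bigcup => [|u _|[i j]]; first exact: finite_finset.
      exact: measurable_tie.
    exact: S_neq.
  move=> w /= /not_implyP[_].
  apply: contra_notP => nS.
  rewrite -[RHS]/(count_rank_lt w) count_rank_ltE card_rank_inj// ?card_ord//.
  move=> i j Sij; apply/eqP/negPn/negP => ij; apply: nS.
  by exists (i, j).
have Pfin : (fine (P (rank_lt ord_max)))%:E = P (rank_lt ord_max).
  by rewrite fineK// fin_num_measure//; exact: measurable_rank_lt.
rewrite (eq_bigr (fun=> (fine (P (rank_lt ord_max)))%:E)); last first.
  by move=> i _; rewrite Pfin; exact: exchangeable_rank_lt.
rewrite -[in X in _ -> X]Pfin sumEFin sumr_const card_ord.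
by rewrite -[fine _ *+ _]mulr_natr => -[->]; rewrite mulfK// pnatr_eq0.
Qed.
End rank_probability.

(** * The conformal score *)

(** Stating it through counts lets it serve both for the residuals inside a score and for the
    calibration scores. *)
Lemma measurable_order_statistic d (T : measurableType d) (R : realType)
    (I : finType) (f : I -> T -> R) (Y : T -> R) k :
  (forall i, measurable_fun [set: T] (f i)) ->
  (forall x t, (Y x <= t) = (k <= #|[pred i | (f i x <= t)%R]|)%N) ->
  measurable_fun [set: T] Y.
Proof.
move=> mf YE; apply: (measurability _ (RGenOInfty.measurableE R)) => //.
move=> _ [_ [t ->] <-]; rewrite setTI.
have -> : Y @^-1` `]t, +oo[%classic =
    [set x | (#|[pred i | (f i x <= t)%R]| < k)%N].
  by apply/seteqP; split => x /=; rewrite in_itv /= andbT ltNge YE -ltnNge.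
by apply: measurable_count_lt => i; exact: measurable_fun_ler.
Qed.

Lemma sort_map_EFin (R : realType) (s : seq R) :
  sort <=%O [seq y%:E | y <- s] = [seq y%:E | y <- sort <=%O s].
Proof.
by rewrite sort_map; congr map; apply: eq_sort.
Qed.

Lemma measurable_coord d (T : measurableType d) (R : realType) m
    (f : T -> 'rV[R]_m) i :
  measurable_fun [set: T] (f : T -> borel 'rV[R]_m) ->
  measurable_fun [set: T] (fun a => f a ord0 i).
Proof.
move=> mf; apply: (measurability _ (RGenOpens.measurableE R)) => //.
move=> _ [_ [a [b ->] <-]].
apply: (mf measurableT ((fun v : 'rV[R]_m => v ord0 i) @^-1` `]a, b[%classic)).
apply: sub_sigma_algebra; apply: open_comp => [v _|].
  exact: coord_continuous.
exact: interval_open.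
Qed.

Lemma measurable_euclidean_norm_sub d (T : measurableType d) (R : realType) m
    (f g : T -> 'rV[R]_m) :
  measurable_fun [set: T] (f : T -> borel 'rV[R]_m) ->
  measurable_fun [set: T] (g : T -> borel 'rV[R]_m) ->
  measurable_fun [set: T] (fun a => euclidean_norm (f a - g a)).
Proof.
move=> mf mg; apply: (measurableT_comp (f := @Num.sqrt R)).
  by apply: continuous_measurable_fun; exact: sqrt_continuous.
apply: measurable_sum => i; apply: measurable_funX.
have -> : (fun a => (f a - g a) ord0 i) = (fun a => f a ord0 i - g a ord0 i).
  by apply/funext => a; rewrite !mxE.
by apply: measurable_funB; exact: measurable_coord.
Qed.

Section score.
Context {R : realType} {A : Type} {d du M : nat}.
Variables (x : 'I_M -> 'rV[R]_d) (Gdag Ghat : A -> 'rV[R]_d -> 'rV[R]_du)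
  (Ehat : A -> 'rV[R]_d -> R) (gamma : R).
Hypotheses (M_gt0 : (0 < M)%N) (gamma_in01 : 0 < gamma < 1)
  (Ehat_gt0 : forall j a, 0 < Ehat a (x j)).

Local Notation residual := (residual Gdag Ghat Ehat).
Local Notation containment := (containment x Gdag Ghat Ehat).
Local Notation score := (score x Gdag Ghat Ehat gamma).
Local Notation covered := (covered x Gdag Ghat Ehat).

Definition coverage_count : nat := `|Num.ceil ((1 - gamma) * M%:R)|%N.

Definition real_score (a : A) : R :=
  nth 0 (sort <=%O [seq residual a (x j) | j <- enum 'I_M]) coverage_count.-1.

Lemma coverage_countP m :
  (1 - gamma <= M%:R^-1 * m%:R) = (coverage_count <= m)%N.
Proof.
have M0 : 0 < M%:R :> R by rewrite ltr0n.
rewrite mulrC ler_pdivlMr// -[m%:R]/(m%:Z%:~R : R) -ceil_le_int.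
rewrite -lez_nat /coverage_count gez0_abs// -(ler_int R).
apply: le_trans (ceil_ge _); rewrite mulr_ge0 ?ler0n// subr_ge0 ltW//.
by case/andP: gamma_in01.
Qed.

Lemma coverage_count_bounds : (0 < coverage_count <= M)%N.
Proof.
rewrite -coverage_countP mulVf ?pnatr_eq0 -?lt0n//.
rewrite ltnNge -coverage_countP mulr0 -ltNge.
by case/andP: gamma_in01 => g0 g1; rewrite subr_gt0 g1 lerBlDr lerDl ltW.
Qed.

Lemma containmentE lam a : (1 - gamma <= containment lam a) =
  (coverage_count <= #|[pred j | ((residual a (x j))%:E <= lam)%E]|)%N.
Proof. by rewrite -coverage_countP card_sum_pred natr_sum. Qed.

Lemma real_score_le a t : (real_score a <= t) =
  (coverage_count <= #|[pred j | (residual a (x j) <= t)%R]|)%N.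
Proof.
rewrite nth_sort_le_count ?count_codom//.
by rewrite size_map size_enum_ord coverage_count_bounds.
Qed.

Lemma containment_EFin a t :
  (1 - gamma <= containment t%:E a) = (real_score a <= t).
Proof.
by rewrite containmentE real_score_le; congr (_ <= _)%N; apply: eq_card.
Qed.

Lemma containmenty a : 1 - gamma <= containment +oo%E a.
Proof.
rewrite containmentE (_ : #|_| = M); first by case/andP: coverage_count_bounds.
by rewrite -[RHS](card_ord M); apply: eq_card => j; rewrite !inE leey.
Qed.

Lemma residual_ge0 j a : 0 <= residual a (x j).
Proof. by rewrite /Defs.residual divr_ge0 ?sqrtr_ge0// ltW. Qed.

Lemma real_score_ge0 a : 0 <= real_score a.
Proof.
rewrite le_nth_sort_count; last first.
  by rewrite size_map size_enum_ord coverage_count_bounds.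
rewrite count_codom eq_card0; first by case/andP: coverage_count_bounds.
by move=> j; rewrite !inE ltNge residual_ge0.
Qed.

(** The admissible radii form the closed half-line starting at [real_score a], so the infimum is
    attained and finite. *)
Lemma scoreE a : score a = (real_score a)%:E.
Proof.
apply/eqP; rewrite eq_le; apply/andP; split.
  apply: ereal_inf_lbound; split; first by rewrite lee_fin real_score_ge0.
  by rewrite containment_EFin.
apply: le_ereal_inf_tmp => -[t||] [//= t0]; rewrite ?leey//.
by rewrite containment_EFin lee_fin.
Qed.

(** Since [Ehat] is positive at each [x j], the band condition can be divided by it and becomes a
    bound on the residual, for every extended real [lam]. *)
Lemma nu_M_covered lam a :
  nu_M x (covered lam a) = (containment lam a)%:E.
Proof.
rewrite /nu_M /Defs.containment EFinM; congr (_ * _)%E; rewrite -sumEFin.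
apply: eq_bigr => j _; rewrite diracE; congr (_%:R%:E); congr nat_of_bool.
have bandE : band Ghat Ehat lam a (x j) (Gdag a (x j)) =
    ((residual a (x j))%:E <= lam)%E :> Prop.
  by rewrite /Defs.residual EFinM lee_pdivrMr.
apply/idP/idP => [/set_mem[_]|h]; first by rewrite bandE.
by apply/mem_set; rewrite /covered /= bandE; split => //; exists j.
Qed.

End score.

Lemma measurable_real_score dT (T : measurableType dT) (R : realType) d du M
  (x : 'I_M -> 'rV[R]_d) (Gdag Ghat : T -> 'rV[R]_d -> 'rV[R]_du)
  (Ehat : T -> 'rV[R]_d -> R) (gamma : R) :
  (0 < M)%N -> 0 < gamma < 1 ->
  (forall j, measurable_fun [set: T]
     (fun a => Gdag a (x j) : borel 'rV[R]_du)) ->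
  (forall j, measurable_fun [set: T]
     (fun a => Ghat a (x j) : borel 'rV[R]_du)) ->
  (forall j, measurable_fun [set: T] (fun a => Ehat a (x j))) ->
  (forall j a, 0 < Ehat a (x j)) ->
  measurable_fun [set: T] (real_score x Gdag Ghat Ehat gamma).
Proof.
move=> M0 g01 mG mGh mE E0.
apply: (@measurable_order_statistic _ T R 'I_M
  (fun j a => residual Gdag Ghat Ehat a (x j)) _ (@coverage_count R M gamma)).
  move=> j; apply: measurable_funM; first exact: measurable_euclidean_norm_sub.
  (* Positivity allows the inverse to be written as a real power, which is measurable. *)
  have -> : (fun a => (Ehat a (x j))^-1) = (fun a => Ehat a (x j) `^ (-1)).
    by apply/funext => a; rewrite powR_inv1// ltW.
  by apply: (measurableT_comp (f := fun y => y `^ (-1)));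
    first exact: measurable_powR.
by move=> a t; exact: real_score_le.
Qed.

(** * Families of random variables *)

Section transfer.
Context d d' d'' (Omega : measurableType d) (T : measurableType d')
  (T' : measurableType d'') (R : realType) (P : probability Omega R).
Variables (f : T -> T') (mf : measurable_fun [set: T] f).

Let comp_RV_subproof (X : {RV P >-> T}) : measurable_fun [set: Omega] (f \o X).
Proof. exact: measurableT_comp. Qed.

Definition comp_RV (X : {RV P >-> T}) : {RV P >-> T'} :=
  HB.pack (f \o X) (isMeasurableFun.Build _ _ _ _ _ (comp_RV_subproof X)).

Lemma exchangeable_comp m (A : 'I_m -> {RV P >-> T}) :
  exchangeable A -> exchangeable (fun i => comp_RV (A i)).
Proof.
move=> Aex s B mB.
pose F (u : m.-tuple T) : m.-tuple T' := [tuple f (tnth u i) | i < m].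
have mF : measurable_fun [set: m.-tuple T] F.
  apply/measurable_fun_tnthP => i.
  rewrite (_ : _ \o F = f \o (@tnth m T ^~ i)).
    by apply: measurableT_comp => //; exact: measurable_tnth.
  by apply/funext => u; rewrite /= tnth_mktuple.
have mFB : measurable (F @^-1` B) by rewrite -[_ @^-1` _]setTI; exact: mF.
have FE (g : 'I_m -> T) : F [tuple g i | i < m] = [tuple f (g i) | i < m].
  by apply: eq_from_tnth => i; rewrite !tnth_mktuple.
have := Aex s _ mFB; rewrite /preimage /=.
by under eq_set do rewrite FE; under [X in _ = P X]eq_set do rewrite FE.
Qed.

Lemma mutually_independent_comp m (A : 'I_m -> {RV P >-> T}) :
  mutually_independent A -> mutually_independent (fun i => comp_RV (A i)).
Proof.
move=> Aind B mB; apply: (Aind (fun i => f @^-1` B i)) => i.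
by rewrite -[_ @^-1` _]setTI; exact: mf.
Qed.

End transfer.

Section subfamilies.
Context d d' (Omega : measurableType d) (T : measurableType d') (R : realType).
Variables (P : probability Omega R).

Lemma mutually_independent_lift n (A : 'I_n.+1 -> {RV P >-> T}) :
  mutually_independent A ->
  mutually_independent (fun i => A (lift ord_max i)).
Proof.
move=> Aind B mB.
pose B' i := if unlift ord_max i is Some j then B j else setT.
have /Aind : forall i, measurable (B' i) by rewrite /B' => i; case: unlift.
rewrite big_ord_recr bigcap_fintype big_ord_recr /= /B' unlift_none.
rewrite preimage_setT setIT probability_setT mule1 bigcap_fintype.
under eq_bigr do rewrite widen_ord_lift_max liftK.
by under [in RHS]eq_bigr do rewrite widen_ord_lift_max liftK.
Qed.

Lemma mutually_independent_pair m (A : 'I_m -> {RV P >-> T}) i j B C :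
  mutually_independent A -> i != j -> measurable B -> measurable C ->
  P (A i @^-1` B `&` A j @^-1` C) = (P (A i @^-1` B) * P (A j @^-1` C))%E.
Proof.
move=> Aind ij mB mC.
pose D l := if l == i then B else if l == j then C else setT.
have ji : (j == i) = false by rewrite eq_sym (negbTE ij).
have Di : D i = B by rewrite /D eqxx.
have Dj : D j = C by rewrite /D ji eqxx.
have /Aind : forall l, measurable (D l).
  by rewrite /D => l; case: ifP => // _; case: ifP.
rewrite (bigD1 i)//= (bigD1 j) ?ji//= big1 ?mule1; last first.
  move=> l /andP[li lj].
  by rewrite /D (negbTE li) (negbTE lj) preimage_setT probability_setT.
rewrite Di Dj => <-; congr (P _); apply/seteqP; split => [w [Bw Cw] l _|w Dw].
  by rewrite /= /D; case: eqP => [->//|_]; case: eqP => [->|].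
by split; [have := Dw i Logic.I|have := Dw j Logic.I]; rewrite /= ?Di ?Dj.
Qed.

End subfamilies.

(** The sections of the diagonal are single points, which are null for the law of [S j]. *)
Lemma mutually_independent_no_ties d (Omega : measurableType d) (R : realType)
    (P : probability Omega R) m (S : 'I_m -> {RV P >-> R}) i j :
  mutually_independent S -> i != j ->
  (forall c : R, P (S j @^-1` [set c]) = 0%E) ->
  P [set w | S i w = S j w] = 0%E.
Proof.
move=> Sind ij Sj0; pose E := [set u : R * R | u.1 = u.2].
have mE : measurable E.
  rewrite (_ : E = (fun u : R * R => u.1 == u.2) @^-1` [set true]).
    by rewrite -[_ @^-1` _]setTI; exact: measurable_fun_eqr.
  by apply/seteqP; split => u /eqP.
have SiSj (B C : set R) : measurable B -> measurable C ->
    P (S i @^-1` B `&` S j @^-1` C) = (P (S i @^-1` B) * P (S j @^-1` C))%E.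
  exact: mutually_independent_pair.
rewrite -[LHS]/(P [set w | E (S i w, S j w)]).
rewrite (independent_pair_section SiSj mE).
rewrite integral0_eq// => w _.
rewrite (_ : xsection E (S i w) = [set S i w]) ?Sj0//.
apply/seteqP; split => y; first by move=> /xsectionP /esym.
by move=> ->; exact/xsectionP.
Qed.

Section order_statistic_rank.
Context d (Omega : measurableType d) (R : realType) (P : probability Omega R).
Variables (n k : nat) (S : 'I_n.+1 -> {RV P >-> R}).

Definition order_statistic (w : Omega) : R :=
  nth 0 (sort <=%O [seq S (lift ord_max i) w | i <- enum 'I_n]) k.-1.

Let size_bounds w : (0 < k <= n)%N ->
  (0 < k <= size [seq S (lift ord_max i) w | i <- enum 'I_n])%N.
Proof. by rewrite size_map size_enum_ord. Qed.

Lemma order_statistic_le w t : (0 < k <= n)%N -> (order_statistic w <= t) =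
  (k <= #|[pred i | (S (lift ord_max i) w <= t)%R]|)%N.
Proof.
by move=> kn; rewrite nth_sort_le_count ?count_codom//; exact: size_bounds.
Qed.

(** The test value is never strictly below itself, so its rank among all [n.+1] values counts
    calibration values only. *)
Let card_lift w : #|[pred j | (S j w < S ord_max w)%R]| =
  #|[pred i | (S (lift ord_max i) w < S ord_max w)%R]|.
Proof.
rewrite !card_sum_pred big_ord_recr /= ltxx addn0.
by apply: eq_bigr => i _; rewrite widen_ord_lift_max.
Qed.

Lemma rank_lt_order_statistic : (0 < k <= n)%N ->
  rank_lt k S ord_max = [set w | S ord_max w <= order_statistic w].
Proof.
move=> kn; apply/funext => w; rewrite /rank_lt /= card_lift.
by rewrite le_nth_sort_count ?count_codom//; exact: size_bounds.
Qed.

Lemma rank_lt_setT : (n < k)%N -> rank_lt k S ord_max = setT.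
Proof.
move=> nk; apply/seteqP; split => // w _; rewrite /rank_lt /= card_lift.
by apply: leq_ltn_trans nk; rewrite -[leqRHS](card_ord n) max_card.
Qed.

End order_statistic_rank.

(** This serves the case [k = n.+1], where the radius is infinite and coverage is certain. *)
Lemma is_cond_prob_setT d (Omega : measurableType d) (R : realType)
    (P : probability Omega R) (G : set (set Omega)) :
  <<s G >> `<=` measurable -> is_cond_prob P <<s G >> setT (fun=> 1).
Proof.
move=> Gm; split.
- move=> B _; rewrite preimage_cst.
  by case: ifPn => _; [exact: (@measurableT _ (g_sigma_algebraType G))|
    exact: (@measurable0 _ (g_sigma_algebraType G))].
- exact: finite_measure_integrable_cst.
- move=> H GH; rewrite setTI -[RHS]mul1e.
  exact: (integral_cst P (Gm _ GH) 1%E).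
Qed.

(** * Coverage *)

Lemma lambda_hatE (R : realType) (T : Type) d du M (x : 'I_M -> 'rV[R]_d)
    (Gdag Ghat : T -> 'rV[R]_d -> 'rV[R]_du) (Ehat : T -> 'rV[R]_d -> R)
    (gamma : R) n k (a : 'I_n -> T) :
  (0 < M)%N -> 0 < gamma < 1 -> (forall j a, 0 < Ehat a (x j)) ->
  (0 < k <= n)%N ->
  lambda_hat x Gdag Ghat Ehat gamma k a =
  (nth 0 (sort <=%O [seq real_score x Gdag Ghat Ehat gamma (a i)
    | i <- enum 'I_n]) k.-1)%:E.
Proof.
move=> M0 g01 E0 /andP[k0 kn]; rewrite /lambda_hat kn.
under eq_map do rewrite scoreE//.
(* The position [k.-1] is below the length, so the default value may change from [+oo] to 0. *)
rewrite (map_comp (fun y => y%:E)) sort_map_EFin (nth_map 0)//.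
by rewrite size_sort size_map size_enum_ord prednK.
Qed.

Theorem theorem2p5 (R : realType) (d du M n k : nat)
    (D : set 'rV[R]_d)
    (D_bounded : bounded_set D)
    (D_measurable : lebesgue_measurable D)
    (D_volume : (0 < lebesgue_outer D < +oo)%E)
    (M_gt0 : (0 < M)%N)
    (x : 'I_M -> 'rV[R]_d)
    (x_inj : injective x)
    (x_in_D : range x `<=` D)
    (V : completeNormedModType R)
    (V_separable : separable V)
    (mu : probability (borel V) R)
    (Gdag Ghat : V -> 'rV[R]_d -> 'rV[R]_du)
    (Ehat : V -> 'rV[R]_d -> R)
    (Gdag_measurable : forall j, measurable_fun [set: borel V]
       (fun a : borel V => Gdag a (x j) : borel 'rV[R]_du))
    (Ghat_measurable : forall j, measurable_fun [set: borel V]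
       (fun a : borel V => Ghat a (x j) : borel 'rV[R]_du))
    (Ehat_measurable : forall j, measurable_fun [set: borel V]
       (fun a : borel V => Ehat a (x j)))
    (Ehat_gt0 : forall j a, 0 < Ehat a (x j))
    (alpha gamma : R)
    (alpha_in01 : 0 < alpha < 1)
    (gamma_in01 : 0 < gamma < 1)
    (n_gt0 : (0 < n)%N)
    (k_def : k%:Z = Num.ceil ((1 - alpha) * n.+1%:R))
    (disp : measure_display) (Omega : measurableType disp)
    (P : probability Omega R)
    (A : 'I_n.+1 -> {RV P >-> borel V})
    (A_exchangeable : exchangeable A)
    (A_law : forall i (B : set (borel V)), measurable B ->
       distribution P (A i) B = mu B) :
  let calibration := fun w (i : 'I_n) => A (lift ord_max i) w in
  let lam := fun w => lambda_hat x Gdag Ghat Ehat gamma k (calibration w) in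
  let coverage_event := [set w | ((1 - gamma)%:E <=
      nu_M x (covered x Gdag Ghat Ehat (lam w) (A ord_max w)))%E] in
  let containment_event := [set w | 1 - gamma <=
      containment x Gdag Ghat Ehat (lam w) (A ord_max w)] in
  let calibration_sigma :=
    g_sigma_preimage (fun i : 'I_n => A (lift ord_max i) : Omega -> borel V) in
  [/\ ((k%:R / n.+1%:R)%:E <= P coverage_event)%E,
      1 - alpha <= k%:R / n.+1%:R &
      mutually_independent A ->
      atomless_law P (fun w => score x Gdag Ghat Ehat gamma (A ord0 w)) ->
      [/\ exists Z : Omega -> R,
            is_cond_prob P calibration_sigma containment_event Z,
          forall Z : Omega -> R,
            is_cond_prob P calibration_sigma containment_event Z ->
            forall B : set R, measurable B ->
              P (Z @^-1` B) = beta_law k (n.+1 - k) B,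
          P coverage_event = (k%:R / n.+1%:R)%:E &
          k%:R / n.+1%:R <= 1 - alpha + n.+1%:R^-1]].

Proof.
set s := real_score x Gdag Ghat Ehat gamma.
have ms : measurable_fun [set: borel V] (s : borel V -> R).
  exact: (@measurable_real_score _ (borel V)).
have ms' (B : set R) : measurable B -> measurable (s @^-1` B : set (borel V)).
  by move=> mB; rewrite -[_ @^-1` _]setTI; exact: ms.
have k_gt0 : (0 < k)%N.
  rewrite -ltz_nat k_def -(ltr_int R) (lt_le_trans _ (ceil_ge _))//.
  by rewrite mulr_gt0 ?ltr0n// subr_gt0; case/andP: alpha_in01.
have k_le : (k <= n.+1)%N.
  rewrite -lez_nat k_def ceil_le_int ler_piMl ?ler0n//.
  by rewrite gerBl ltW//; case/andP: alpha_in01.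
pose S i := comp_RV ms (A i).
have Sex : exchangeable S by exact: exchangeable_comp.
move=> calibration lam coverage_event containment_event calibration_sigma.
have SE i w : S i w = s (A i w) by [].
have lamE w : (k <= n)%N -> lam w = (order_statistic k S w)%:E.
  by move=> kn; rewrite /lam lambda_hatE// k_gt0.
have containment_eventE : containment_event = rank_lt k S ord_max.
  have [kn|nk] := leqP k n.
    rewrite rank_lt_order_statistic ?k_gt0//.
    apply/seteqP; split => w; rewrite /containment_event /=;
      by rewrite lamE// containment_EFin.
  rewrite rank_lt_setT//; apply/seteqP; split => // w _.
  rewrite /containment_event /= /lam /lambda_hat leqNgt nk /=.
  exact: containmenty.
have coverage_eventE : coverage_event = rank_lt k S ord_max.
  rewrite -containment_eventE; apply/seteqP; split => w;
    by rewrite /coverage_event /containment_event /= nu_M_covered// lee_fin.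
have kE : k%:R = (Num.ceil ((1 - alpha) * n.+1%:R))%:~R :> R by rewrite -k_def.
split.
- by rewrite coverage_eventE; exact: exchangeable_rank_lt_ge.
- by rewrite ler_pdivlMr ?ltr0n// kE ceil_ge.
move=> Aind S0.
have Sind : mutually_independent S by exact: mutually_independent_comp.
have S_law i (B : set R) : measurable B -> P (S i @^-1` B) = P (S ord0 @^-1` B).
  move=> /ms' mB.
  rewrite -[LHS]/(distribution P (A i) (s @^-1` B)).
  by rewrite -[RHS]/(distribution P (A ord0) (s @^-1` B)) !A_law.
(* The absence of atoms is assumed for the first score and passes to the others through the common
   law. *)
have Satom i (c : R) : P (S i @^-1` [set c]) = 0%E.
  rewrite S_law// -[RHS](S0 c%:E); congr (P _); apply/seteqP; split => w /=;
    rewrite scoreE//; [by move=> <-|by case].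
(* [G] is the generating family of [calibration_sigma], named so that the lemmas on [<<s G >>]
   apply. *)
set G := \big[setU/set0]_(i < n)
  preimage_set_system setT (A (lift ord_max i) : Omega -> borel V) measurable.
have Gm : <<s G >> `<=` measurable.
  apply: smallest_sub; first exact: sigma_algebra_measurable.
  move=> H; rewrite /G -bigcup_seq => -[i _ [B mB <-]].
  exact: measurable_funP.
have SG i (B : set R) : measurable B -> <<s G >> (S (lift ord_max i) @^-1` B).
  move=> mB; apply: sub_sigma_algebra; rewrite /G -bigcup_seq.
  exists i; first by rewrite /= mem_index_enum.
  by exists (s @^-1` B); [exact: ms'|rewrite setTI].
(* All versions have the same law, so it suffices to exhibit one with the beta law. *)
have beta_unique Z0 : is_cond_prob P calibration_sigma containment_event Z0 ->
    (forall B : set R, measurable B ->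
       P (Z0 @^-1` B) = beta_law k (n.+1 - k) B) ->
    forall Z, is_cond_prob P calibration_sigma containment_event Z ->
    forall B : set R, measurable B -> P (Z @^-1` B) = beta_law k (n.+1 - k) B.
  move=> Z0c Z0b Z Zc B mB; rewrite -Z0b//.
  exact: (is_cond_prob_law_unique Gm Zc Z0c).
have [Z Zc Zb] : exists2 Z,
    is_cond_prob P calibration_sigma containment_event Z &
    forall B : set R, measurable B -> P (Z @^-1` B) = beta_law k (n.+1 - k) B.
  have [kn|nk] := leqP k n; last first.
    have -> : k = n.+1 by apply/eqP; rewrite eqn_leq k_le.
    exists (fun=> 1).
      rewrite containment_eventE rank_lt_setT//; exact: is_cond_prob_setT.
    move=> B mB; rewrite subnn /= diracE preimage_cst.
    by case: ifPn => _; rewrite ?probability_setT ?measure0.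
  have kn' : (0 < k <= n)%N by rewrite k_gt0.
  (* Writing [n.+1 - k] as a successor selects the [beta_prob] branch of [beta_law]. *)
  rewrite containment_eventE rank_lt_order_statistic// subSn//= -subSn//.
  have mYG : measurable_fun [set: g_sigma_algebraType G] (order_statistic k S).
    apply: (@measurable_order_statistic _ (g_sigma_algebraType G) R 'I_n
      (fun i => S (lift ord_max i)) _ k).
      by move=> i _ B mB; rewrite setTI; exact: SG.
    by move=> w t; exact: order_statistic_le.
  have mY : measurable_fun [set: Omega] (order_statistic k S).
    move=> _ B mB; rewrite setTI; apply: Gm.
    by rewrite -[_ @^-1` _]setTI; exact: mYG.
  pose Y : {RV P >-> R} := HB.pack (order_statistic k S)
    (isMeasurableFun.Build _ _ _ _ _ mY).
  exists (fun w => fine (cdf (S ord_max) (order_statistic k S w))).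
    apply: is_cond_prob_cdf => //.
      move=> H C GH mC.
      apply: (@mutually_independent_g_sigma_preimage _ _ _ _ _ P n A H
        (s @^-1` C)) => //.
      exact: ms'.
    move=> B mB; rewrite -[_ @^-1` _]setTI; exact: mYG.
  apply: (@cdf_order_statistic_beta _ _ _ P n k (fun i => S (lift ord_max i))
     (S ord_max) Y) => //.
  - exact: mutually_independent_lift.
  - by move=> i t; rewrite S_law// -(S_law ord_max).
  - by move=> w t; exact: order_statistic_le.
split.
- by exists Z.
- exact: beta_unique Zc Zb.
- rewrite coverage_eventE; apply: exchangeable_rank_lt_eq => // i j ij.
  exact: mutually_independent_no_ties.
- rewrite ler_pdivrMr ?ltr0n// mulrDl mulVf ?pnatr_eq0// kE.
  (* The upper bound is that a ceiling exceeds its argument by less than 1. *)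
  by rewrite -lerBlDr ltW// -[X in _ - X]/(1%:~R) -intrB ceilB1_lt.
Qed.
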